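(* Let $\mathcal{E}$ be a category with pullbacks, let $\mathbf{Span}(\mathcal{E})$ be the bicategory of spans in $\mathcal{E}$, and let $\mathscr{C}$ be a bicategory. Then to give an oplax functor $L\colon\mathbf{Span}(\mathcal{E})\to\mathscr{C}$ is to give a locally defined functor $$L_{X,Y}\colon\mathbf{Span}(\mathcal{E})_{X,Y}\to\mathscr{C}_{LX,LY},\qquad X,Y\in\mathcal{E},$$ together with 2-cells $$\Phi_{s,h,t}\colon L(s,t)\to L(s,h);L(h,t),\qquad\Lambda_h\colon L(h,h)\to1_{LX},$$ the former for every triple of morphisms $s\colon T\to X$, $h\colon T\to Y$, $t\colon T\to Z$ in $\mathcal{E}$ with common domain, the latter for every morphism $h\colon T\to X$ in $\mathcal{E}$, such that: (1) for all $u\colon R\to X$, $k\colon R\to Y$, $v\colon R\to Z$, all $s\colon T\to X$, $h\colon T\to Y$, $t\colon T\to Z$ and every $f\colon R\to T$ with $sf=u$, $hf=k$, $tf=v$ (so that $f$ is a morphism of spans $(u,v)\to(s,t)$, $(u,k)\to(s,h)$ and $(k,v)\to(h,t)$), one has $$\Phi_{s,h,t}\circ Lf=(Lf;Lf)\circ\Phi_{u,k,v}\colon L(u,v)\to L(s,h);L(h,t);$$ (2) for all $p\colon M\to X$, $q\colon N\to X$ and $f\colon M\to N$ with $qf=p$ (so that $f$ is a morphism of spans $(p,p)\to(q,q)$), one has $\Lambda_q\circ Lf=\Lambda_p$; (3) for all morphisms $s\colon T\to W$, $h\colon T\to X$, $k\colon T\to Y$, $t\colon T\to Z$ in $\mathcal{E}$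 one has $$\mathrm{assoc}\circ\bigl(L(s,h);\Phi_{h,k,t}\bigr)\circ\Phi_{s,h,t}=\bigl(\Phi_{s,h,k};L(k,t)\bigr)\circ\Phi_{s,k,t}$$ as 2-cells $L(s,t)\to\bigl(L(s,h);L(h,k)\bigr);L(k,t)$; (4) for every span $(s,t)$ from $X$ to $Y$, the composite $\bigl(\Lambda_s;L(s,t)\bigr)\circ\Phi_{s,s,t}$ is the unitor $L(s,t)\to1_{LX};L(s,t)$ and the composite $\bigl(L(s,t);\Lambda_t\bigr)\circ\Phi_{s,t,t}$ is the unitor $L(s,t)\to L(s,t);1_{LY}$.
   Context: $\mathbf{Span}(\mathcal{E})$ has the objects of $\mathcal{E}$; a 1-cell $X\to Z$ is a span $X\xleftarrow{s}T\xrightarrow{t}Z$, written $(s,t)$; a 2-cell $(a,b)\to(u,v)$, with apexes $K$ and $R$, is a morphism $f\colon K\to R$ in $\mathcal{E}$ with $uf=a$, $vf=b$; 1-cells are composed by pullback. For a bicategory $\mathscr{A}$, $\mathscr{A}_{X,Y}$ denotes the hom-category. Composition in bicategories is written in diagrammatic order with ''$;$'' (for $a\colon X\to Y$, $b\colon Y\to Z$ the composite is $a;b\colon X\to Z$), also for horizontal composition of 2-cells; a 1-cell in a horizontal composite of 2-cells stands for its identity 2-cell; $\circ$ is vertical composition. ''assoc'' and ''unitor'' denote the appropriate components of the associativity and unit constraints of $\mathscr{C}$ (or their inverses). A locally defined functor is an assignment $X\mapsto LX$ on objects together with functors $L_{X,Y}$ on hom-categories. An oplax functor is a locally defined functor with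 2-cells $L(a;b)\to La;Lb$ natural in $a,b$ and $L1_X\to1_{LX}$ satisfying the usual associativity and unit axioms. ''To give … is to give …'' means that, for a fixed locally defined functor $L$, the two kinds of structure are in bijection. *)

(* Defs.v *)
From mathcomp Require Import ssreflect ssrfun.
From Stdlib Require Import ProofIrrelevance.

Set Implicit Arguments.
Unset Strict Implicit.
Unset Printing Implicit Defensive.

Declare Scope cat_scope.
Delimit Scope cat_scope with cat.
Local Open Scope cat_scope.

Reserved Notation "g ∘ f" (at level 40, left associativity).

Record category := Category {
  ob :> Type;
  hom : ob -> ob -> Type;
  idm : forall X, hom X X;
  comp : forall X Y Z, hom Y Z -> hom X Y -> hom X Z
    where "g ∘ f" := (comp g f);
  comp_idl : forall X Y (f : hom X Y), idm Y ∘ f = f;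
  comp_idr : forall X Y (f : hom X Y), f ∘ idm X = f;
  compA : forall W X Y Z (h : hom Y Z) (g : hom X Y) (f : hom W X),
    h ∘ (g ∘ f) = h ∘ g ∘ f
}.
Arguments hom {c}.
Arguments idm {c} X.
Arguments comp {c X Y Z} g f.

Notation "g ∘ f" := (comp g f) : cat_scope.

Record functor (A B : category) := Functor {
  fob :> A -> B;
  fmap : forall X Y, hom X Y -> hom (fob X) (fob Y);
  fmap_id : forall X, fmap (idm X) = idm (fob X);
  fmap_comp : forall X Y Z (g : hom Y Z) (f : hom X Y),
    fmap (g ∘ f) = fmap g ∘ fmap f
}.
Arguments fmap {A B} _ {X Y} _.

(** Horizontal composition, of 1-cells ([a ⊙ b]) and of 2-cells ([α ⊛ β]), is
    written in diagrammatic order; vertical composition [∘] is not. *)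

Reserved Notation "a ⊙ b" (at level 38, left associativity).
Reserved Notation "α ⊛ β" (at level 38, left associativity).

Record bicategory := Bicategory {
  cell0 :> Type;
  cell : cell0 -> cell0 -> category;
  one : forall X, cell X X;
  hcomp : forall X Y Z, cell X Y -> cell Y Z -> cell X Z
    where "a ⊙ b" := (hcomp a b);
  hcomp2 : forall X Y Z (a a' : cell X Y) (b b' : cell Y Z),
    hom a a' -> hom b b' -> hom (a ⊙ b) (a' ⊙ b')
    where "α ⊛ β" := (hcomp2 α β);
  hcomp2_id : forall X Y Z (a : cell X Y) (b : cell Y Z),
    idm a ⊛ idm b = idm (a ⊙ b);
  hcomp2_comp : forall X Y Z (a a' a'' : cell X Y) (b b' b'' : cell Y Z)
    (α : hom a a') (α' : hom a' a'') (β : hom b b') (β' : hom b' b''),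
    (α' ∘ α) ⊛ (β' ∘ β) = (α' ⊛ β') ∘ (α ⊛ β);

  assoc : forall W X Y Z (a : cell W X) (b : cell X Y) (c : cell Y Z),
    hom (a ⊙ b ⊙ c) (a ⊙ (b ⊙ c));
  assocV : forall W X Y Z (a : cell W X) (b : cell X Y) (c : cell Y Z),
    hom (a ⊙ (b ⊙ c)) (a ⊙ b ⊙ c);
  assocK : forall W X Y Z (a : cell W X) (b : cell X Y) (c : cell Y Z),
    assocV a b c ∘ assoc a b c = idm (a ⊙ b ⊙ c);
  assocVK : forall W X Y Z (a : cell W X) (b : cell X Y) (c : cell Y Z),
    assoc a b c ∘ assocV a b c = idm (a ⊙ (b ⊙ c));
  assoc_nat : forall W X Y Z
    (a a' : cell W X) (b b' : cell X Y) (c c' : cell Y Z)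
    (α : hom a a') (β : hom b b') (γ : hom c c'),
    assoc a' b' c' ∘ (α ⊛ β ⊛ γ) = (α ⊛ (β ⊛ γ)) ∘ assoc a b c;

  lunit : forall X Y (a : cell X Y), hom (one X ⊙ a) a;
  lunitV : forall X Y (a : cell X Y), hom a (one X ⊙ a);
  lunitK : forall X Y (a : cell X Y), lunitV a ∘ lunit a = idm (one X ⊙ a);
  lunitVK : forall X Y (a : cell X Y), lunit a ∘ lunitV a = idm a;
  lunit_nat : forall X Y (a a' : cell X Y) (α : hom a a'),
    lunit a' ∘ (idm (one X) ⊛ α) = α ∘ lunit a;

  runit : forall X Y (a : cell X Y), hom (a ⊙ one Y) a;
  runitV : forall X Y (a : cell X Y), hom a (a ⊙ one Y);
  runitK : forall X Y (a : cell X Y), runitV a ∘ runit a = idm (a ⊙ one Y);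
  runitVK : forall X Y (a : cell X Y), runit a ∘ runitV a = idm a;
  runit_nat : forall X Y (a a' : cell X Y) (α : hom a a'),
    runit a' ∘ (α ⊛ idm (one Y)) = α ∘ runit a;

  triangle : forall X Y Z (a : cell X Y) (b : cell Y Z),
    (idm a ⊛ lunit b) ∘ assoc a (one Y) b = runit a ⊛ idm b;
  pentagon : forall V W X Y Z
    (a : cell V W) (b : cell W X) (c : cell X Y) (d : cell Y Z),
    (idm a ⊛ assoc b c d) ∘ assoc a (b ⊙ c) d ∘ (assoc a b c ⊛ idm d)
    = assoc a b (c ⊙ d) ∘ assoc (a ⊙ b) c d
}.
Arguments cell {_} _ _.
Arguments one {_} X.
Arguments hcomp {_ X Y Z} _ _.
Arguments hcomp2 {_ X Y Z a a' b b'} _ _.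
Arguments assoc {_ W X Y Z} _ _ _.
Arguments assocV {_ W X Y Z} _ _ _.
Arguments lunit {_ X Y} _.
Arguments lunitV {_ X Y} _.
Arguments runit {_ X Y} _.
Arguments runitV {_ X Y} _.

Notation "a ⊙ b" := (hcomp a b) : cat_scope.
Notation "α ⊛ β" := (hcomp2 α β) : cat_scope.

Record locally_defined_functor (A B : bicategory) := LocallyDefinedFunctor {
  lob :> A -> B;
  lfun : forall X Y : A, functor (cell X Y) (cell (lob X) (lob Y))
}.
Arguments lfun {A B} l {X Y}.

Record oplax_structure (A B : bicategory) (L : locally_defined_functor A B) :=
  OplaxStructure {
  oplax_comp : forall (X Y Z : A) (a : cell X Y) (b : cell Y Z),
    hom (lfun L (a ⊙ b)) (lfun L a ⊙ lfun L b);
  oplax_unit : forall X : A, hom (lfun L (one X)) (one (L X));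
  oplax_comp_nat : forall (X Y Z : A) (a a' : cell X Y) (b b' : cell Y Z)
    (α : hom a a') (β : hom b b'),
    oplax_comp a' b' ∘ fmap (lfun L) (α ⊛ β)
    = (fmap (lfun L) α ⊛ fmap (lfun L) β) ∘ oplax_comp a b;
  oplax_assoc : forall (W X Y Z : A)
    (a : cell W X) (b : cell X Y) (c : cell Y Z),
    assoc (lfun L a) (lfun L b) (lfun L c)
      ∘ (oplax_comp a b ⊛ idm (lfun L c)) ∘ oplax_comp (a ⊙ b) c
    = (idm (lfun L a) ⊛ oplax_comp b c) ∘ oplax_comp a (b ⊙ c)
      ∘ fmap (lfun L) (assoc a b c);
  oplax_lunit : forall (X Y : A) (a : cell X Y),
    lunit (lfun L a) ∘ (oplax_unit X ⊛ idm (lfun L a)) ∘ oplax_comp (one X) a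
    = fmap (lfun L) (lunit a);
  oplax_runit : forall (X Y : A) (a : cell X Y),
    runit (lfun L a) ∘ (idm (lfun L a) ⊛ oplax_unit Y) ∘ oplax_comp a (one Y)
    = fmap (lfun L) (runit a)
}.

(** A category with pullbacks is taken with a choice of pullback for every
    cospan; composition of spans depends on that choice. *)

Record pullbacks (E : category) := Pullbacks {
  pb : forall X Y Z : E, hom X Z -> hom Y Z -> E;
  pb1 : forall (X Y Z : E) (f : hom X Z) (g : hom Y Z), hom (pb f g) X;
  pb2 : forall (X Y Z : E) (f : hom X Z) (g : hom Y Z), hom (pb f g) Y;
  pb_comm : forall (X Y Z : E) (f : hom X Z) (g : hom Y Z),
    f ∘ pb1 f g = g ∘ pb2 f g;
  pb_pair : forall (X Y Z : E) (f : hom X Z) (g : hom Y Z)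
    (W : E) (a : hom W X) (b : hom W Y), f ∘ a = g ∘ b -> hom W (pb f g);
  pb_pair1 : forall (X Y Z : E) (f : hom X Z) (g : hom Y Z)
    (W : E) (a : hom W X) (b : hom W Y) (e : f ∘ a = g ∘ b),
    pb1 f g ∘ pb_pair e = a;
  pb_pair2 : forall (X Y Z : E) (f : hom X Z) (g : hom Y Z)
    (W : E) (a : hom W X) (b : hom W Y) (e : f ∘ a = g ∘ b),
    pb2 f g ∘ pb_pair e = b;
  pb_uniq : forall (X Y Z : E) (f : hom X Z) (g : hom Y Z)
    (W : E) (m n : hom W (pb f g)),
    pb1 f g ∘ m = pb1 f g ∘ n -> pb2 f g ∘ m = pb2 f g ∘ n -> m = n
}.
Arguments pb {E} p {X Y Z} f g.
Arguments pb1 {E p X Y Z} f g.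
Arguments pb2 {E p X Y Z} f g.
Arguments pb_comm {E p X Y Z} f g.
Arguments pb_pair {E p X Y Z f g W} a b e.
Arguments pb_pair1 {E p X Y Z f g W a b} e.
Arguments pb_pair2 {E p X Y Z f g W a b} e.
Arguments pb_uniq {E p X Y Z f g W m n} _ _.

Section SpanHomCategory.
Variable E : category.

Record span (X Y : E) := Span {
  apex : E;
  lleg : hom apex X;
  rleg : hom apex Y
}.

Record span_hom (X Y : E) (a b : span X Y) := SpanHom {
  span_mor : hom (apex a) (apex b);
  span_morl : lleg b ∘ span_mor = lleg a;
  span_morr : rleg b ∘ span_mor = rleg a
}.

Lemma span_hom_eq (X Y : E) (a b : span X Y) (f g : span_hom a b) :
  span_mor f = span_mor g -> f = g.
Proof.
case: f g => [f fl fr] [g gl gr] /= e.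
by case: _ / e gl gr => gl gr; f_equal; apply: proof_irrelevance.
Qed.

#[local] Obligation Tactic := idtac.

Program Definition span_id (X Y : E) (a : span X Y) : span_hom a a :=
  @SpanHom X Y a a (idm (apex a)) _ _.
Next Obligation. by move=> *; rewrite comp_idr. Qed.
Next Obligation. by move=> *; rewrite comp_idr. Qed.

Program Definition span_vcomp (X Y : E) (a b c : span X Y)
    (g : span_hom b c) (f : span_hom a b) : span_hom a c :=
  @SpanHom X Y a c (span_mor g ∘ span_mor f) _ _.
Next Obligation. by move=> *; rewrite compA !span_morl. Qed.
Next Obligation. by move=> *; rewrite compA !span_morr. Qed.

Program Definition span_cat (X Y : E) : category :=
  @Category (span X Y) (@span_hom X Y) (@span_id X Y) (@span_vcomp X Y) _ _ _.
Next Obligation. by move=> *; apply: span_hom_eq; apply: comp_idl. Qed.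
Next Obligation. by move=> *; apply: span_hom_eq; apply: comp_idr. Qed.
Next Obligation. by move=> *; apply: span_hom_eq; apply: compA. Qed.

End SpanHomCategory.
Arguments apex {E X Y} _.
Arguments lleg {E X Y} _.
Arguments rleg {E X Y} _.
Arguments Span {E X Y apex} lleg rleg.
Arguments SpanHom {E X Y a b} span_mor span_morl span_morr.

Section SpanBicategory.
Variables (E : category) (P : pullbacks E).

Local Notation p1 := (pb1 _ _).
Local Notation p2 := (pb2 _ _).

Definition span_one (X : E) : span X X := Span (idm X) (idm X).

Definition span_hcomp (X Y Z : E) (a : span X Y) (b : span Y Z) : span X Z :=
  Span (lleg a ∘ pb1 (p := P) (rleg a) (lleg b))
       (rleg b ∘ pb2 (p := P) (rleg a) (lleg b)).

Lemma pair1A (X Y Z W V : E) (f : hom X Z) (g : hom Y Z)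
    (a : hom W X) (b : hom W Y) (e : f ∘ a = g ∘ b) (c : hom X V) :
  c ∘ pb1 (p := P) f g ∘ pb_pair a b e = c ∘ a.
Proof. by rewrite -compA pb_pair1. Qed.

Lemma pair2A (X Y Z W V : E) (f : hom X Z) (g : hom Y Z)
    (a : hom W X) (b : hom W Y) (e : f ∘ a = g ∘ b) (c : hom Y V) :
  c ∘ pb2 (p := P) f g ∘ pb_pair a b e = c ∘ b.
Proof. by rewrite -compA pb_pair2. Qed.

Lemma morlA (X Y V : E) (a b : span X Y) (f : span_hom a b) (c : hom X V) :
  c ∘ lleg b ∘ span_mor f = c ∘ lleg a.
Proof. by rewrite -compA span_morl. Qed.

Lemma morrA (X Y V : E) (a b : span X Y) (f : span_hom a b) (c : hom Y V) :
  c ∘ rleg b ∘ span_mor f = c ∘ rleg a.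
Proof. by rewrite -compA span_morr. Qed.

Lemma commA (X Y Z V : E) (f : hom X Z) (g : hom Y Z) (c : hom Z V) :
  c ∘ f ∘ pb1 (p := P) f g = c ∘ g ∘ pb2 f g.
Proof. by rewrite -!compA pb_comm. Qed.

Lemma comm1l (X Y : E) (g : hom Y X) :
  pb1 (p := P) (idm X) g = g ∘ pb2 (idm X) g.
Proof. by rewrite -pb_comm comp_idl. Qed.

Lemma comm1r (X Y : E) (f : hom X Y) :
  pb2 (p := P) f (idm Y) = f ∘ pb1 f (idm Y).
Proof. by rewrite pb_comm comp_idl. Qed.

Local Ltac nf := rewrite /=; repeat first
  [ rewrite compA | rewrite pb_pair1 | rewrite pb_pair2
  | rewrite pair1A | rewrite pair2A | rewrite span_morl | rewrite span_morr
  | rewrite morlA | rewrite morrA | rewrite comp_idl | rewrite comp_idr ].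
Local Ltac span_tac := intros; try apply: span_hom_eq; nf;
  rewrite ?(pb_comm, commA) //; nf;
  do ?[done | by rewrite comm1l | by rewrite comm1r | apply: pb_uniq; nf; rewrite ?(pb_comm, commA) //; nf].

#[local] Obligation Tactic := idtac.

Program Definition span_hcomp2 (X Y Z : E)
    (a a' : span X Y) (b b' : span Y Z) (f : span_hom a a') (g : span_hom b b') :
    span_hom (span_hcomp a b) (span_hcomp a' b') :=
  @SpanHom E X Z (span_hcomp a b) (span_hcomp a' b')
    (pb_pair (span_mor f ∘ p1) (span_mor g ∘ p2) _) _ _.
Next Obligation. span_tac. Qed.
Next Obligation. span_tac. Qed.
Next Obligation. span_tac. Qed.

Program Definition span_assoc (W X Y Z : E)
    (a : span W X) (b : span X Y) (c : span Y Z) :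
    span_hom (span_hcomp (span_hcomp a b) c) (span_hcomp a (span_hcomp b c)) :=
  @SpanHom E W Z (span_hcomp (span_hcomp a b) c) (span_hcomp a (span_hcomp b c))
    (pb_pair (p1 ∘ p1) (pb_pair (p2 ∘ p1) p2 _) _) _ _.
Next Obligation. span_tac. Qed.
Next Obligation. span_tac. Qed.
Next Obligation. span_tac. Qed.
Next Obligation. span_tac. Qed.

Program Definition span_assocV (W X Y Z : E)
    (a : span W X) (b : span X Y) (c : span Y Z) :
    span_hom (span_hcomp a (span_hcomp b c)) (span_hcomp (span_hcomp a b) c) :=
  @SpanHom E W Z (span_hcomp a (span_hcomp b c)) (span_hcomp (span_hcomp a b) c)
    (pb_pair (pb_pair p1 (p1 ∘ p2) _) (p2 ∘ p2) _) _ _.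
Next Obligation. span_tac. Qed.
Next Obligation. span_tac. Qed.
Next Obligation. span_tac. Qed.
Next Obligation. span_tac. Qed.

Program Definition span_lunit (X Y : E) (a : span X Y) :
    span_hom (span_hcomp (span_one X) a) a :=
  @SpanHom E X Y (span_hcomp (span_one X) a) a p2 _ _.
Next Obligation. span_tac. Qed.
Next Obligation. span_tac. Qed.

Program Definition span_lunitV (X Y : E) (a : span X Y) :
    span_hom a (span_hcomp (span_one X) a) :=
  @SpanHom E X Y a (span_hcomp (span_one X) a)
    (pb_pair (lleg a) (idm (apex a)) _) _ _.
Next Obligation. span_tac. Qed.
Next Obligation. span_tac. Qed.
Next Obligation. span_tac. Qed.

Program Definition span_runit (X Y : E) (a : span X Y) :
    span_hom (span_hcomp a (span_one Y)) a :=
  @SpanHom E X Y (span_hcomp a (span_one Y)) a p1 _ _.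
Next Obligation. span_tac. Qed.
Next Obligation. span_tac. Qed.

Program Definition span_runitV (X Y : E) (a : span X Y) :
    span_hom a (span_hcomp a (span_one Y)) :=
  @SpanHom E X Y a (span_hcomp a (span_one Y))
    (pb_pair (idm (apex a)) (rleg a) _) _ _.
Next Obligation. span_tac. Qed.
Next Obligation. span_tac. Qed.
Next Obligation. span_tac. Qed.

Program Definition Span_bicat : bicategory :=
  @Bicategory E (@span_cat E) span_one span_hcomp span_hcomp2 _ _
    span_assoc span_assocV _ _ _
    span_lunit span_lunitV _ _ _
    span_runit span_runitV _ _ _ _ _.
Next Obligation. span_tac. Qed.
Next Obligation. span_tac. Qed.
Next Obligation. span_tac. Qed.
Next Obligation. span_tac. Qed.
Next Obligation. span_tac. Qed.
Next Obligation. span_tac. Qed.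
Next Obligation. span_tac. Qed.
Next Obligation. span_tac. Qed.
Next Obligation. span_tac. Qed.
Next Obligation. span_tac. Qed.
Next Obligation. span_tac. Qed.
Next Obligation. span_tac. Qed.
Next Obligation. span_tac. Qed.

End SpanBicategory.

(** [span2 f e1 e2] is [f], seen as a morphism of spans [(u, v) -> (s, t)]. *)
Definition span2 (E : category) (P : pullbacks E) (X Y R T : E)
    (u : hom R X) (v : hom R Y) (s : hom T X) (t : hom T Y) (f : hom R T)
    (e1 : s ∘ f = u) (e2 : t ∘ f = v) :
    @hom (@cell (Span_bicat P) X Y) (Span u v) (Span s t) :=
  @SpanHom E X Y (Span u v) (Span s t) f e1 e2.
Arguments span2 {E} P {X Y R T u v s t} f e1 e2.

(** [on_span L s t] is the 1-cell [L(s, t)]. *)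
Definition on_span (E : category) (P : pullbacks E) (C : bicategory)
    (L : locally_defined_functor (Span_bicat P) C)
    (X Y T : E) (s : hom T X) (t : hom T Y) : @cell C (lob L X) (lob L Y) :=
  fob (@lfun _ _ L X Y) (Span s t).

Record span_oplax_data (E : category) (P : pullbacks E) (C : bicategory)
    (L : locally_defined_functor (Span_bicat P) C) :=
  SpanOplaxData {
  Phi : forall (X Y Z T : E) (s : hom T X) (h : hom T Y) (t : hom T Z),
    hom (on_span L s t) (on_span L s h ⊙ on_span L h t);
  Lambda : forall (X T : E) (h : hom T X),
    hom (on_span L h h) (one (lob L X));

  Phi_nat : forall (X Y Z R T : E)
    (u : hom R X) (k : hom R Y) (v : hom R Z)
    (s : hom T X) (h : hom T Y) (t : hom T Z) (f : hom R T)
    (es : s ∘ f = u) (eh : h ∘ f = k) (et : t ∘ f = v),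
    Phi s h t ∘ fmap (lfun L) (span2 P f es et)
    = (fmap (lfun L) (span2 P f es eh) ⊛ fmap (lfun L) (span2 P f eh et))
      ∘ Phi u k v;

  Lambda_nat : forall (X M N : E) (p : hom M X) (q : hom N X) (f : hom M N)
    (e : q ∘ f = p),
    Lambda q ∘ fmap (lfun L) (span2 P f e e) = Lambda p;

  Phi_assoc : forall (W X Y Z T : E)
    (s : hom T W) (h : hom T X) (k : hom T Y) (t : hom T Z),
    assocV (on_span L s h) (on_span L h k) (on_span L k t)
      ∘ (idm (on_span L s h) ⊛ Phi h k t) ∘ Phi s h t
    = (Phi s h k ⊛ idm (on_span L k t)) ∘ Phi s k t;

  Phi_lunit : forall (X Y T : E) (s : hom T X) (t : hom T Y),
    (Lambda s ⊛ idm (on_span L s t)) ∘ Phi s s t = lunitV (on_span L s t);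
  Phi_runit : forall (X Y T : E) (s : hom T X) (t : hom T Y),
    (idm (on_span L s t) ⊛ Lambda t) ∘ Phi s t t = runitV (on_span L s t)
}.

(* Main.v *)
From mathcomp Require Import ssreflect ssrfun.
From Stdlib Require Import FunctionalExtensionality ProofIrrelevance.
Require Import Defs.

(** A morphism of spans from [(u, v)] to a composite [a ⊙ b] is the same thing
    as a choice of middle leg [k] with morphisms of spans [x : (u, k) -> a] and
    [y : (k, v) -> b], because the apex of [a ⊙ b] is a pullback. Every such
    morphism thus factors as [(x ⊛ y) ∘ δ], where [δ] is the diagonal
    [(u, v) -> (u, k) ⊙ (k, v)]. An oplax constraint [φ], being natural, is
    therefore determined by the composites [φ ∘ L δ], and these composites are
    the 2-cells [Φ]. Conversely, with [p] and [q] the two projections of the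
    pullback, [φ a b] is recovered as [(L p ⊛ L q) ∘ Φ].

    Both passages are governed by one identity, [cone_law]:
      [φ a b ∘ L f = (L x ⊛ L y) ∘ Φ u k v]
    whenever [f] has components [x] and [y]. It holds for the [Φ] made from an
    oplax structure, by naturality of [φ] ([cone_law_of_oplax]), and for the
    [φ] made from the data, by naturality of [Φ] ([cone_law_of_data]). Each
    associativity or unit axiom on one side is turned by it into the
    corresponding axiom on the other: for associativity, a triple composite of
    spans is replaced by the four legs out of its single apex. The identity
    with [f] the identity, or with [f] the diagonal, shows that [φ] and [Φ]
    determine each other, so the two passages are mutually inverse.

    The units are simpler: every [(h, h)] has the morphism [h] to the identity
    span, so [Λ h] is the counit [ε] composed with [L h], and [ε] is [Λ] at an
    identity. *)

Set Implicit Arguments.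
Unset Strict Implicit.
Unset Printing Implicit Defensive.

Local Open Scope cat_scope.

(** * Pasting calculus in a bicategory *)

Section Whiskering.
Variable C : bicategory.

Lemma hcomp2_compl (X Y Z : C) (a a' a'' : cell X Y) (b b' : cell Y Z)
    (α : hom a a') (α' : hom a' a'') (β : hom b b') :
  (α' ⊛ idm b') ∘ (α ⊛ β) = (α' ∘ α) ⊛ β.
Proof. by rewrite -hcomp2_comp comp_idl. Qed.

Lemma hcomp2_compr (X Y Z : C) (a a' : cell X Y) (b b' b'' : cell Y Z)
    (α : hom a a') (β : hom b b') (β' : hom b' b'') :
  (idm a' ⊛ β') ∘ (α ⊛ β) = α ⊛ (β' ∘ β).
Proof. by rewrite -hcomp2_comp comp_idl. Qed.

Lemma eq_assocV (W X Y Z : C) (a : cell W X) (b : cell X Y) (c : cell Y Z)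
    (d : cell W Z) (α : hom d (a ⊙ (b ⊙ c))) (β : hom d (a ⊙ b ⊙ c)) :
  α = assoc a b c ∘ β -> assocV a b c ∘ α = β.
Proof. by move->; rewrite compA assocK comp_idl. Qed.

Lemma eq_lunitV (X Y : C) (a : cell X Y) (α : hom a (one X ⊙ a)) :
  lunit a ∘ α = idm a -> α = lunitV a.
Proof. by move=> e; rewrite -[α]comp_idl -lunitK -compA e comp_idr. Qed.

Lemma eq_runitV (X Y : C) (a : cell X Y) (α : hom a (a ⊙ one Y)) :
  runit a ∘ α = idm a -> α = runitV a.
Proof. by move=> e; rewrite -[α]comp_idl -runitK -compA e comp_idr. Qed.

(** The associativity axiom for the data compares 2-cells into [a ⊙ b ⊙ c],
    whereas the oplax axiom is met after the three 1-cells have been mapped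
    along [α], [β], [γ]. Naturality of the associator bridges the two. The
    2-cells [φ1], ..., [φ4] stand for the four values of [Φ] involved. *)
Lemma assoc_coherent (W X Y Z : C) (a a' : cell W X) (b b' : cell X Y)
    (c c' : cell Y Z) (ac : cell W Y) (bd : cell X Z) (d : cell W Z)
    (α : hom a a') (β : hom b b') (γ : hom c c')
    (φ1 : hom d (a ⊙ bd)) (φ2 : hom bd (b ⊙ c))
    (φ3 : hom ac (a ⊙ b)) (φ4 : hom d (ac ⊙ c)) :
  assocV a b c ∘ (idm a ⊛ φ2) ∘ φ1 = (φ3 ⊛ idm c) ∘ φ4 ->
  assoc a' b' c' ∘ (((α ⊛ β) ∘ φ3) ⊛ γ) ∘ φ4
    = (α ⊛ ((β ⊛ γ) ∘ φ2)) ∘ φ1.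
Proof.
move=> e; rewrite -[γ in LHS]comp_idr -[α in RHS]comp_idr !hcomp2_comp.
rewrite -!compA -e !compA assoc_nat.
by rewrite -[_ ∘ assocV _ _ _]compA assocVK comp_idr.
Qed.

(** The unit counterparts of [assoc_coherent]: a one-sided counit law persists
    after mapping the remaining 1-cell along [α]. *)
Lemma lunit_coherent (X Y : C) (o : cell X X) (a a' : cell X Y)
    (λ : hom o (one X)) (φ : hom a (o ⊙ a)) (α : hom a a') :
  (λ ⊛ idm a) ∘ φ = lunitV a -> lunit a' ∘ (λ ⊛ α) ∘ φ = α.
Proof.
have -> : λ ⊛ α = (idm (one X) ⊛ α) ∘ (λ ⊛ idm a).
  by rewrite hcomp2_compr comp_idr.
move=> e; rewrite -!compA e compA lunit_nat.
by rewrite -compA lunitVK comp_idr.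
Qed.

Lemma runit_coherent (X Y : C) (o : cell Y Y) (a a' : cell X Y)
    (λ : hom o (one Y)) (φ : hom a (a ⊙ o)) (α : hom a a') :
  (idm a ⊛ λ) ∘ φ = runitV a -> runit a' ∘ (α ⊛ λ) ∘ φ = α.
Proof.
have -> : α ⊛ λ = (α ⊛ idm (one Y)) ∘ (idm a ⊛ λ).
  by rewrite hcomp2_compl comp_idr.
move=> e; rewrite -!compA e compA runit_nat.
by rewrite -compA runitVK comp_idr.
Qed.

End Whiskering.

(** * Structures with the same 2-cells are equal *)

Section Extensionality.
Variables (E : category) (P : pullbacks E) (C : bicategory).

Lemma oplax_structure_eq (A : bicategory) (L : locally_defined_functor A C)
    (F G : oplax_structure L) :
  (forall X Y Z (a : cell X Y) (b : cell Y Z),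
     oplax_comp F a b = oplax_comp G a b) ->
  (forall X, oplax_unit F X = oplax_unit G X) -> F = G.
Proof.
case: F G => [f1 f0 F1 F2 F3 F4] [g1 g0 G1 G2 G3 G4] /= e1 e0.
have {}e1 : f1 = g1 by do 5!apply: functional_extensionality_dep => ?.
have {}e0 : f0 = g0 by apply: functional_extensionality_dep.
by subst; f_equal; apply: proof_irrelevance.
Qed.

Lemma span_oplax_data_eq (L : locally_defined_functor (Span_bicat P) C)
    (D D' : span_oplax_data L) :
  (forall X Y Z T (s : hom T X) (h : hom T Y) (t : hom T Z),
     Phi D s h t = Phi D' s h t) ->
  (forall X T (h : hom T X), Lambda D h = Lambda D' h) -> D = D'.
Proof.
case: D D' => [f1 f0 F1 F2 F3 F4 F5] [g1 g0 G1 G2 G3 G4 G5] /= e1 e0.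
have {}e1 : f1 = g1 by do 7!apply: functional_extensionality_dep => ?.
have {}e0 : f0 = g0 by do 3!apply: functional_extensionality_dep => ?.
by subst; f_equal; apply: proof_irrelevance.
Qed.

End Extensionality.

(** * Morphisms into a composite span *)

Section Correspondence.
Variables (E : category) (P : pullbacks E) (C : bicategory).
Variable L : locally_defined_functor (Span_bicat P) C.

Local Notation S := (Span_bicat P).
Local Notation spans X Y := (@cell S X Y).
Local Notation "'Lf' f" := (fmap (lfun L) f) (at level 10, f at level 9).

#[local] Obligation Tactic := idtac.

Section ProjectionsAndDiagonal.
Variables X Y Z : E.

Definition span_proj1 (a : spans X Y) (b : spans Y Z) :
    @hom (spans X Y) (Span (lleg a ∘ pb1 (rleg a) (lleg b))
                           (rleg a ∘ pb1 (rleg a) (lleg b))) a :=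
  @SpanHom E X Y (Span _ _) a (pb1 (p := P) (rleg a) (lleg b)) erefl erefl.

Definition span_proj2 (a : spans X Y) (b : spans Y Z) :
    @hom (spans Y Z) (Span (rleg a ∘ pb1 (rleg a) (lleg b))
                           (rleg b ∘ pb2 (rleg a) (lleg b))) b :=
  @SpanHom E Y Z (Span _ _) b (pb2 (p := P) (rleg a) (lleg b))
    (esym (pb_comm _ _)) erefl.

Lemma span_pairP (a : spans X Y) (b : spans Y Z) (K : E)
    (u : hom K X) (k : hom K Y) (v : hom K Z)
    (x : @hom (spans X Y) (Span u k) a) (y : @hom (spans Y Z) (Span k v) b) :
  rleg a ∘ span_mor x = lleg b ∘ span_mor y.
Proof. by rewrite span_morr span_morl. Qed.

Program Definition span_pair (a : spans X Y) (b : spans Y Z) (K : E)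
    (u : hom K X) (k : hom K Y) (v : hom K Z)
    (x : @hom (spans X Y) (Span u k) a) (y : @hom (spans Y Z) (Span k v) b) :
    @hom (spans X Z) (Span u v) (a ⊙ b) :=
  @SpanHom E X Z (Span u v) (span_hcomp P a b)
    (pb_pair (span_mor x) (span_mor y) (span_pairP x y)) _ _.
Next Obligation.
by move=> a b K u k v x y; rewrite /= pair1A; apply: (span_morl x).
Qed.
Next Obligation.
by move=> a b K u k v x y; rewrite /= pair2A; apply: (span_morr y).
Qed.

End ProjectionsAndDiagonal.

Definition span_diag (X Y Z T : E) (s : hom T X) (h : hom T Y) (t : hom T Z) :
    @hom (spans X Z) (Span s t) (hcomp (b0:=S) (Span s h) (Span h t)) :=
  span_pair (idm (Span s h : spans X Y)) (idm (Span h t : spans Y Z)).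

(** The morphism [f] is given by its two components rather than as a
    [span_pair], so that the law applies as it stands to morphisms such as
    associators, unitors and identities. *)
Definition cone_law
    (φ : forall (X Y Z : E) (a : spans X Y) (b : spans Y Z),
       hom (lfun L (a ⊙ b)) (lfun L a ⊙ lfun L b))
    (Φ : forall (X Y Z T : E) (s : hom T X) (h : hom T Y) (t : hom T Z),
       hom (on_span L s t) (on_span L s h ⊙ on_span L h t)) :=
  forall (X Y Z : E) (a : spans X Y) (b : spans Y Z) (K : E)
    (u : hom K X) (k : hom K Y) (v : hom K Z)
    (x : @hom (spans X Y) (Span u k) a) (y : @hom (spans Y Z) (Span k v) b)
    (f : @hom (spans X Z) (Span u v) (a ⊙ b)),
    pb1 (p := P) (rleg a) (lleg b) ∘ span_mor f = span_mor x ->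
    pb2 (p := P) (rleg a) (lleg b) ∘ span_mor f = span_mor y ->
  φ X Y Z a b ∘ Lf f = (Lf x ⊛ Lf y) ∘ Φ X Y Z K u k v.

(** * From an oplax structure to the data *)

Section FromOplax.
Variable F : oplax_structure L.
Local Notation φ := (oplax_comp F).
Local Notation ε := (oplax_unit F).

Definition Phi_of X Y Z T (s : hom T X) (h : hom T Y) (t : hom T Z) :
    hom (on_span L s t) (on_span L s h ⊙ on_span L h t) :=
  φ (Span s h : spans X Y) (Span h t : spans Y Z) ∘ Lf (span_diag s h t).

Definition leg_to_one (X T : E) (h : hom T X) :
    @hom (spans X X) (Span h h) (one (b0:=S) X) :=
  @SpanHom E X X (Span h h) (span_one X) h (comp_idl h) (comp_idl h).

Definition Lambda_of X T (h : hom T X) : hom (on_span L h h) (one (L X)) :=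
  ε X ∘ Lf (leg_to_one h).

(** Naturality of [φ] in [x] and [y], since [f = (x ⊛ y) ∘ δ]. *)
Lemma cone_law_of_oplax : cone_law (fun X Y Z => @oplax_comp _ _ _ F X Y Z) Phi_of.
Proof.
move=> X Y Z a b K u k v x y f e1 e2.
rewrite /Phi_of compA -oplax_comp_nat -compA -fmap_comp; congr (_ ∘ Lf _).
apply: span_hom_eq; apply: (@pb_uniq _ P) => /=; rewrite compA.
  by rewrite pb_pair1 pair1A e1 comp_idr.
by rewrite pb_pair2 pair2A e2 comp_idr.
Qed.

Program Definition span_oplax_data_of : span_oplax_data L :=
  @SpanOplaxData E P C L Phi_of Lambda_of _ _ _ _ _.
Next Obligation.
move=> X Y Z R T u k v s h t f es eh et.
rewrite {1}/Phi_of -compA -fmap_comp.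
by apply: cone_law_of_oplax; rewrite /= compA ?pb_pair1 ?pb_pair2 comp_idl.
Qed.
Next Obligation.
move=> X M N p q f e; rewrite /Lambda_of -compA -fmap_comp; congr (_ ∘ Lf _).
exact: span_hom_eq.
Qed.
Next Obligation.
move=> W X Y Z T s h k t; rewrite -compA; apply: eq_assocV.
pose a : spans W X := Span s h; pose b : spans X Y := Span h k.
pose c : spans Y Z := Span k t.
(* The ternary diagonal, bracketed to the left. *)
pose d := span_pair (span_diag s h k) (idm c).
have -> : (Phi_of s h k ⊛ idm (on_span L k t)) ∘ Phi_of s k t
    = (φ a b ⊛ idm (lfun L c)) ∘ φ (a ⊙ b) c ∘ Lf d.
  rewrite -compA (cone_law_of_oplax (x := span_diag s h k) (y := idm c)) /=;
    rewrite ?pb_pair1 ?pb_pair2 //.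
  by rewrite [RHS]compA (fmap_id (lfun L)) hcomp2_compl.
rewrite [RHS]compA [X in _ = X ∘ _]compA (oplax_assoc F a b c).
rewrite -[RHS]compA -fmap_comp.
(* The associator carries [d] to the ternary diagonal bracketed to the right,
   as its components show. *)
rewrite -compA (cone_law_of_oplax (x := idm a) (y := span_diag h k t)) /=;
  rewrite ?compA ?pb_pair1 ?pb_pair2 //.
- by rewrite hcomp2_compr fmap_id.
- by rewrite -compA pb_pair1 pb_pair1.
apply: (@pb_uniq _ P); rewrite compA ?pb_pair1 ?pb_pair2 //.
by rewrite -compA pb_pair1 pb_pair2.
Qed.
Next Obligation.
move=> X Y T s t; apply: eq_lunitV.
pose a : spans X Y := Span s t.
rewrite -[RHS](fmap_id (lfun L) a).
have -> : (Lambda_of s ⊛ idm (on_span L s t)) ∘ Phi_of s s t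
    = (ε X ⊛ idm (lfun L a)) ∘ (φ (one (b0:=S) X) a ∘ Lf (lunitV a)).
  rewrite (cone_law_of_oplax (x := leg_to_one s) (y := idm a)) /=;
    rewrite ?pb_pair1 ?pb_pair2 //.
  by rewrite [RHS]compA (fmap_id (lfun L)) hcomp2_compl.
by rewrite !compA (oplax_lunit F a) -fmap_comp lunitVK.
Qed.
Next Obligation.
move=> X Y T s t; apply: eq_runitV.
pose a : spans X Y := Span s t.
rewrite -[RHS](fmap_id (lfun L) a).
have -> : (idm (on_span L s t) ⊛ Lambda_of t) ∘ Phi_of s t t
    = (idm (lfun L a) ⊛ ε Y) ∘ (φ a (one (b0:=S) Y) ∘ Lf (runitV a)).
  rewrite (cone_law_of_oplax (x := idm a) (y := leg_to_one t)) /=;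
    rewrite ?pb_pair1 ?pb_pair2 //.
  by rewrite [RHS]compA (fmap_id (lfun L)) hcomp2_compr.
by rewrite !compA (oplax_runit F a) -fmap_comp runitVK.
Qed.

End FromOplax.

(** * From the data to an oplax structure *)

Section ToOplax.
Variable D : span_oplax_data L.

Definition comp_of (X Y Z : E) (a : spans X Y) (b : spans Y Z) :
    hom (lfun L (a ⊙ b)) (lfun L a ⊙ lfun L b) :=
  (Lf (span_proj1 a b) ⊛ Lf (span_proj2 a b)) ∘ Phi D _ _ _.

Definition unit_of (X : E) : hom (lfun L (one (b0:=S) X)) (one (L X)) :=
  Lambda D (idm X).

(** Naturality of [Φ] along the underlying morphism of [f] from the apex of
    [(u, v)] to the pullback, followed by functoriality of [L]. *)
Lemma cone_law_of_data : cone_law comp_of (fun X Y Z T => @Phi _ _ _ _ D X Y Z T).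
Proof.
move=> X Y Z a b K u k v x y f e1 e2.
have eh : rleg a ∘ pb1 (p := P) (rleg a) (lleg b) ∘ span_mor f = k.
  by rewrite -compA e1; apply: (span_morr x).
have -> : f = span2 P (span_mor f) (span_morl f) (span_morr f).
  exact: span_hom_eq.
rewrite /comp_of -compA (Phi_nat D (span_morl f) eh (span_morr f)) compA.
rewrite -hcomp2_comp -!fmap_comp.
by congr ((Lf _ ⊛ Lf _) ∘ _); apply: span_hom_eq.
Qed.

Program Definition oplax_structure_of : oplax_structure L :=
  @OplaxStructure S C L comp_of unit_of _ _ _ _.
Next Obligation.
move=> X Y Z a a' b b' α β.
rewrite /comp_of compA -hcomp2_comp -!fmap_comp.
apply: (cone_law_of_data (x := α ∘ span_proj1 a b) (y := β ∘ span_proj2 a b)).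
  exact: pb_pair1.
exact: pb_pair2.
Qed.
Next Obligation.
move=> W X Y Z a b c.
(* The apex of [(a ⊙ b) ⊙ c] has legs to [W], [X], [Y] and [Z], with [h] the
   leg to [X], and projections [x], [y], [z] onto [a], [b], [c]. Both sides
   become these projections applied after 2-cells [Φ] on the four legs. *)
pose p := span_proj1 (a ⊙ b) c; pose z := span_proj2 (a ⊙ b) c.
pose m : hom _ (pb P (rleg a) (lleg b)) := span_mor p.
pose h := rleg a ∘ (pb1 (p := P) (rleg a) (lleg b) ∘ m).
have eh : lleg b ∘ (pb2 (p := P) (rleg a) (lleg b) ∘ m) = h.
  by rewrite /h !compA (pb_comm (rleg a)).
pose x : @hom (spans W X) (Span (lleg (a ⊙ b) ∘ m) h) a :=
  @SpanHom E _ _ (Span _ _) a (pb1 (p := P) (rleg a) (lleg b) ∘ m)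
    (compA _ _ _) erefl.
pose y : @hom (spans X Y) (Span h (rleg (a ⊙ b) ∘ m)) b :=
  @SpanHom E _ _ (Span _ _) b (pb2 (p := P) (rleg a) (lleg b) ∘ m)
    eh (compA _ _ _).
rewrite [X in _ ∘ X = _]/comp_of -/p -/z [LHS]compA -[X in X ∘ _]compA.
rewrite hcomp2_compl (cone_law_of_data (x := x) (y := y)) //.
rewrite -[RHS]compA.
rewrite (cone_law_of_data (x := x) (y := span_pair y z)); first last.
- by rewrite /= pb_pair2; congr (pb_pair _ _ _); apply: proof_irrelevance.
- exact: pb_pair1.
rewrite [RHS]compA hcomp2_compr (cone_law_of_data (x := y) (y := z)); first last.
- exact: pb_pair2.
- exact: pb_pair1.
exact: assoc_coherent (Phi_assoc D _ _ _ _).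
Qed.
Next Obligation.
move=> X Y a.
rewrite /comp_of [LHS]compA -[X in X ∘ _]compA hcomp2_compl.
rewrite (_ : unit_of X ∘ _ = Lambda D (idm X ∘ pb1 (p := P) _ _)).
  rewrite (lunit_coherent _ (Phi_lunit D _ _)).
  by congr (Lf _); apply: span_hom_eq.
exact: (Lambda_nat D erefl).
Qed.
Next Obligation.
move=> X Y a.
(* [comp_of] takes the middle leg through [a], where it differs from [v] by the
   pullback equation. The cone law for the identity moves it to [v], which makes
   the right unit law for the data applicable. *)
pose v := rleg (one (b0:=S) Y) ∘ pb2 (p := P) (rleg a) (idm Y).
pose u := lleg a ∘ pb1 (p := P) (rleg a) (idm Y).
pose x : @hom (spans X Y) (Span u v) a :=
  @SpanHom E _ _ (Span u v) a (pb1 (p := P) (rleg a) (idm Y)) erefl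
    (pb_comm _ _).
pose y : @hom (spans Y Y) (Span v v) (one (b0:=S) Y) :=
  @SpanHom E _ _ (Span v v) (span_one Y) (pb2 (p := P) (rleg a) (idm Y))
    erefl erefl.
have -> : comp_of a (one (b0:=S) Y) = (Lf x ⊛ Lf y) ∘ Phi D u v v.
  rewrite -[LHS]comp_idr -fmap_id.
  by apply: cone_law_of_data; exact: comp_idr.
rewrite [LHS]compA -[X in X ∘ _]compA hcomp2_compr.
rewrite (_ : unit_of Y ∘ _ = Lambda D v); last exact: (Lambda_nat D erefl).
rewrite (runit_coherent _ (Phi_runit D _ _)).
by congr (Lf _); apply: span_hom_eq.
Qed.

End ToOplax.

(** * The two passages are mutually inverse *)

Lemma span_oplax_data_ofK : cancel span_oplax_data_of oplax_structure_of.
Proof.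
move=> F; apply: oplax_structure_eq => [X Y Z a b | X] /=.
  rewrite /comp_of -[RHS]comp_idr -fmap_id; apply: esym.
  by apply: cone_law_of_oplax; rewrite comp_idr.
rewrite /unit_of /= /Lambda_of -[RHS]comp_idr -fmap_id.
by congr (_ ∘ Lf _); apply: span_hom_eq.
Qed.

Lemma oplax_structure_ofK : cancel oplax_structure_of span_oplax_data_of.
Proof.
move=> D; apply: span_oplax_data_eq => [X Y Z T s h t | X T h] /=.
  pose x := idm (Span s h : spans X Y); pose y := idm (Span h t : spans Y Z).
  rewrite /Phi_of /= (cone_law_of_data D (x := x) (y := y)).
  - by rewrite !fmap_id hcomp2_id comp_idl.
  - exact: pb_pair1.
  - exact: pb_pair2.
exact: (Lambda_nat D (comp_idl h)).
Qed.

End Correspondence.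

Theorem corollary24 (E : category) (P : pullbacks E) (C : bicategory)
    (L : locally_defined_functor (Span_bicat P) C) :
  exists F : oplax_structure L -> span_oplax_data L, bijective F.
Proof.
exists (@span_oplax_data_of E P C L).
exists (@oplax_structure_of E P C L).
  exact: span_oplax_data_ofK.
exact: oplax_structure_ofK.
Qed.
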